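(* Let $d,n$ be positive integers and $0\le k\le n$ an integer. Then $$\left\langle \begin{matrix} n\\ k\end{matrix}\right\rangle_{d,F}=(-1)^{d\binom{k}{2}}\det\left(\binom{n+d+j-i-1}{n-1}_F\right)_{i,j=0}^{k-1}.$$
   Context: $F_n$ are the Fibonacci numbers ($F_0=0$, $F_1=1$, $F_n=F_{n-1}+F_{n-2}$). Fibonomial coefficients: $\binom{m}{k}_F=\prod_{j=0}^{k-1}\frac{F_{m-j}}{F_{k-j}}$ for $0\le k\le m$, and $0$ if $k<0$ or $k>m$. Fibo-Hoggatt numbers: for $0\le k\le n$, $\left\langle \begin{matrix} n\\ k\end{matrix}\right\rangle_{d,F}=\prod_{j=0}^{k-1}\frac{\binom{n-j+d-1}{d}_F}{\binom{k-j+d-1}{d}_F}$. A $0\times0$ determinant equals $1$. *)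

(* Defs.v *)
From mathcomp Require Import all_boot all_order all_algebra.

Set Implicit Arguments.
Unset Strict Implicit.
Unset Printing Implicit Defensive.

Import Order.TTheory GRing.Theory Num.Theory.
Local Open Scope ring_scope.

Fixpoint fib (n : nat) : nat :=
  match n with
  | 0 => 0
  | 1 => 1
  | (m.+1 as p).+1 => fib p + fib m
  end%N.

(* The quotient is taken in rat, so integrality is not built in. *)
Definition fibonomial (m k : nat) : rat :=
  if (k <= m)%N then \prod_(j < k) ((fib (m - j))%:R / (fib (k - j))%:R)
  else 0.

(* Intended for k <= n: no subtraction is then truncated and every
   denominator is nonzero. *)
Definition fibo_hoggatt (d n k : nat) : rat :=
  \prod_(j < k)
    (fibonomial (n - j + d - 1) d / fibonomial (k - j + d - 1) d).

(* Main.v *)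
(** The determinant is computed by induction on [k] and [n].  Put [r = n - 1].
    Up to the factor [F_1 ... F_r], the entries are
    [e(i, j) = \prod_(1 <= t <= r) F_(d + j - i + t)].  Replacing column [j + 1]
    by [F_(d+j+1) * column (j+1) - F_(d+j+r+1) * column j] clears the first row
    except for its first entry, and by Vajda's identity the entry at
    [(i + 1, j + 1)] becomes
    [(-1)^(d+j+i) F_(i+1) F_r \prod_(1 <= t <= r-1) F_(d + j - i + t)].
    Removing row and column factors leaves the matrix of the same shape with
    parameters [(n - 1, k - 1)], while the Fibo-Hoggatt number at [(n, k)] is
    the one at [(n - 1, k - 1)] times its first factor. *)

Require Import Defs.
From mathcomp Require Import all_boot all_order all_algebra.
From mathcomp Require Import ring zify.

Set Implicit Arguments.
Unset Strict Implicit.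
Unset Printing Implicit Defensive.

Import Order.TTheory GRing.Theory Num.Theory.
Local Open Scope ring_scope.

Local Arguments fib : simpl never.

(** * Fibonacci identities: addition law and Vajda's identity *)

Lemma fibSS n : fib n.+2 = (fib n.+1 + fib n)%N.
Proof. by []. Qed.

Lemma fib_gt0 n : (0 < fib n.+1)%N.
Proof. by elim: n => // n IH; rewrite fibSS addn_gt0 IH. Qed.

Lemma fibr_neq0 n : (fib n.+1)%:R != 0 :> rat.
Proof. by rewrite pnatr_eq0 -lt0n fib_gt0. Qed.

Lemma fib_addS m n : fib (m + n).+1 = (fib m.+1 * fib n.+1 + fib m * fib n)%N.
Proof.
elim: m n => [|m IH] n; first by rewrite add0n mul1n mul0n addn0.
by rewrite addSnnS IH !fibSS; ring.
Qed.

(** The addition law turns the left side into [F_(i+1) F_(r+1)] times Cassini's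
    [F_(x+1)^2 - F_(x+2) F_x]; all other terms cancel. *)
Lemma vajda x i r :
  (fib (x + i.+1))%:R * (fib (x + r.+1))%:R
    - (fib (x + i.+1 + r.+1))%:R * (fib x)%:R
  = (-1) ^+ x * (fib i.+1)%:R * (fib r.+1)%:R :> rat.
Proof.
have cassini : (fib x.+1)%:R * (fib x.+1)%:R - (fib x.+2)%:R * (fib x)%:R
    = (-1) ^+ x :> rat.
  elim: x => [|y IH]; first by rewrite expr0 mulr0 subr0 mulr1.
  by rewrite exprS -IH !fibSS !natrD; ring.
rewrite -cassini (addnS (x + i.+1)) (fib_addS (x + i.+1)) (fib_addS x i.+1).
rewrite !addnS !fib_addS.
rewrite !fibSS !(natrD, natrM); ring.
Qed.

(** * Fibonomial coefficients through Fibonacci factorials and runs *)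

Definition fibonorial (n : nat) : rat := \prod_(t < n) (fib t.+1)%:R.

Lemma fibonorial_neq0 n : fibonorial n != 0.
Proof. by apply/prodf_neq0 => t _; exact: fibr_neq0. Qed.

Lemma fibonorialS n : fibonorial n.+1 = fibonorial n * (fib n.+1)%:R.
Proof. by rewrite /fibonorial big_ord_recr. Qed.

Lemma fibonorialD m n :
  fibonorial (m + n) = fibonorial m * \prod_(t < n) (fib (m + t).+1)%:R.
Proof. by rewrite /fibonorial big_split_ord. Qed.

Lemma fibonomialD m r :
  fibonomial (m + r) r = \prod_(t < r) (fib (m + t).+1)%:R / fibonorial r.
Proof.
rewrite /fibonomial leq_addl /fibonorial -prodf_div (reindex_inj rev_ord_inj) /=.
by apply: eq_bigr => t _; congr ((fib _)%:R / (fib _)%:R); have := ltn_ord t; lia.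
Qed.

Lemma fibonomial_sym m r :
  fibonomial (m + r) r = fibonorial (m + r) / (fibonorial m * fibonorial r).
Proof.
rewrite fibonomialD fibonorialD.
have := fibonorial_neq0 m; have := fibonorial_neq0 r => h1 h2; field.
by rewrite h1 h2.
Qed.

(* For [i <= r] truncated subtraction is harmless: as soon as some index
   [d + j + t + 1 - i] would be negative, another one is [0] and the product
   vanishes. *)
Definition fib_run (d r i j : nat) : rat :=
  \prod_(t < r) (fib (d + j + t.+1 - i))%:R.

Lemma fib_run_eq0 d r i j : (d + j < i <= r)%N -> fib_run d r i j = 0.
Proof.
move=> /andP[hlt hle].
have ht : ((i - (d + j)).-1 < r)%N by lia.
rewrite /fib_run (bigD1 (Ordinal ht)) //=.
have -> : (d + j + (i - (d + j)).-1.+1 - i = 0)%N by lia.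
by rewrite mul0r.
Qed.

Lemma fibonomial_run d r i j : (i <= r)%N ->
  fibonomial (r.+1 + d + j - i - 1) r = fib_run d r i j / fibonorial r.
Proof.
move=> hi; case: (leqP i (d + j)) => hij.
  have -> : (r.+1 + d + j - i - 1 = (d + j - i) + r)%N by lia.
  rewrite fibonomialD; congr (_ / _); apply: eq_bigr => t _.
  by congr ((fib _)%:R); lia.
(* If [d + j < i], the upper index is below [r], so the fibonomial is [0] by convention and matches
   the vanishing run. *)
rewrite fib_run_eq0 ?hij // mul0r /fibonomial.
by case: ifP => //; lia.
Qed.

(** Both sides are [F_(d+j+1) ... F_(d+j+r+1)]; this is what clears the first row. *)
Lemma fib_run_first d r j :
  (fib (d + j).+1)%:R * fib_run d r 0 j.+1
  = (fib (d + j + r.+1))%:R * fib_run d r 0 j.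
Proof.
case: r => [|r]; first by rewrite /fib_run !big_ord0 addn1.
have -> : fib_run d r.+1 0 j.+1
    = fib_run d r 0 j.+1 * (fib (d + j + r.+2))%:R.
  by rewrite /fib_run big_ord_recr /= subn0 addnS addSnnS.
have -> : fib_run d r.+1 0 j = (fib (d + j).+1)%:R * fib_run d r 0 j.+1.
  rewrite /fib_run big_ord_recl /= subn0 addn1; congr (_ * _).
  by apply: eq_bigr => t _; congr ((fib _)%:R); rewrite /bump /=; lia.
ring.
Qed.

(** Both runs on the left contain [fib_run d r i j]; the remaining factors form Vajda's expression
    at [x = d + j - i]. *)
Lemma fib_run_reduce d r i j : (i <= r)%N ->
  (fib (d + j).+1)%:R * fib_run d r.+1 i.+1 j.+1
    - (fib (d + j + r.+2))%:R * fib_run d r.+1 i.+1 j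
  = (-1) ^+ d * ((-1) ^+ i * (fib i.+1)%:R) * ((-1) ^+ j * (fib r.+1)%:R)
    * fib_run d r i j.
Proof.
move=> hi.
have -> : fib_run d r.+1 i.+1 j.+1
    = fib_run d r i j * (fib (d + j + r.+1 - i))%:R.
  rewrite /fib_run big_ord_recr /=; congr (_ * (fib _)%:R); last by lia.
  by apply: eq_bigr => t _; congr ((fib _)%:R); lia.
have -> : fib_run d r.+1 i.+1 j = (fib (d + j - i))%:R * fib_run d r i j.
  rewrite /fib_run big_ord_recl /=; congr ((fib _)%:R * _); first by lia.
  by apply: eq_bigr => t _; congr ((fib _)%:R); rewrite /bump /=; lia.
(* When [x] would be negative, the common run is already [0]. *)
case: (leqP i (d + j)) => hij; last by rewrite fib_run_eq0 ?hij //; ring.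
have := vajda (d + j - i) i r.
have -> : (d + j - i + i.+1 = (d + j).+1)%N by lia.
have -> : (d + j - i + r.+1 = d + j + r.+1 - i)%N by lia.
have -> : ((d + j).+1 + r.+1 = d + j + r.+2)%N by lia.
have -> : (-1) ^+ (d + j - i) = (-1) ^+ d * (-1) ^+ i * (-1) ^+ j :> rat.
  rewrite -!exprD -signr_odd -[RHS]signr_odd; congr ((-1) ^+ nat_of_bool _).
  by rewrite oddB // !oddD -addbA -addbA [odd i (+) _]addbC.
move=> hv.
transitivity (((fib (d + j).+1)%:R * (fib (d + j + r.+1 - i))%:R
  - (fib (d + j + r.+2))%:R * (fib (d + j - i))%:R) * fib_run d r i j).
  by ring.
by rewrite hv; ring.
Qed.

Definition fib_run_mx (d r k : nat) : 'M[rat]_k :=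
  \matrix_(i < k, j < k) fib_run d r i j.

(** * Determinants under row and column operations *)

Lemma det_row_col_scale (R : comNzRingType) (k : nat) (a b : 'I_k -> R)
    (A : 'M[R]_k) :
  \det (\matrix_(i, j) (a i * b j * A i j))
  = \prod_i a i * \prod_j b j * \det A.
Proof.
have -> : \matrix_(i, j) (a i * b j * A i j)
    = diag_mx (\row_i a i) *m A *m diag_mx (\row_j b j).
  apply/matrixP => i j; rewrite mul_mx_diag mul_diag_mx !mxE; ring.
rewrite !det_mulmx !det_diag mulrAC.
by congr (_ * _ * _); apply: eq_bigr => i _; rewrite mxE.
Qed.

(** All columns change simultaneously: the new matrix is [A *m U] with [U] upper bidiagonal, of
    diagonal [1, c_0, ..., c_(k-1)]. *)
Lemma det_col_comb (R : comNzRingType) (k : nat) (c c' : 'I_k -> R)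
    (A : 'M[R]_k.+1) :
  \det (\matrix_(i, j)
     if unlift ord0 j is Some l
     then c l * A i (lift ord0 l) - c' l * A i (widen_ord (leqnSn k) l)
     else A i ord0)
  = \det A * \prod_l c l.
Proof.
pose U : 'M[R]_k.+1 := \matrix_(i, j)
  if unlift ord0 j is Some l
  then c l * (i == lift ord0 l)%:R - c' l * (i == widen_ord (leqnSn k) l)%:R
  else (i == ord0)%:R.
have pick (f : 'I_k.+1 -> R) j : \sum_i f i * (i == j)%:R = f j.
  rewrite (bigD1 j) //= eqxx mulr1 big1 ?addr0 // => i /negPf ->.
  by rewrite mulr0.
have -> : \prod_l c l = \det U.
  (* [det_trig] is about lower triangular matrices, hence the transpose. *)
  rewrite -det_tr det_trig; last first.
    apply/is_trig_mxP => i j hij; rewrite !mxE.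
    case: unliftP hij => [l ->|->] /= hij; last by case: eqP => // e; rewrite e in hij.
    have /negPf -> : j != lift ord0 l.
      by apply: contraTneq hij => ->; rewrite ltnn.
    have /negPf -> : j != widen_ord (leqnSn k) l.
      by apply: contraTneq hij => -> /=; rewrite /bump /=; lia.
    by rewrite !mulr0 subr0.
  rewrite big_ord_recl !mxE unlift_none eqxx mul1r.
  apply: eq_bigr => l _; rewrite !mxE liftK eqxx mulr1.
  have /negPf -> : lift ord0 l != widen_ord (leqnSn k) l.
    by rewrite -val_eqE /= /bump /=; lia.
  by rewrite mulr0 subr0.
rewrite -det_mulmx; congr (\det _); apply/matrixP => i j; rewrite !mxE.
under eq_bigr => l _ do rewrite !mxE.
case: (unliftP ord0 j) => [l _|_]; last by rewrite pick.
rewrite -(pick _ (lift ord0 l)) -(pick _ (widen_ord (leqnSn k) l)).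
rewrite !big_distrr /= -sumrB; apply: eq_bigr => m _; ring.
Qed.

(** The product on the left is the factor that the column operations introduce. *)
Lemma det_fib_run_mxS d r k : (k <= r.+1)%N ->
  \det (fib_run_mx d r.+1 k.+1) * \prod_(j < k) (fib (d + j).+1)%:R
  = fib_run d r.+1 0 0 * ((-1) ^+ (d * k) * fibonorial k * (fib r.+1)%:R ^+ k
      * \det (fib_run_mx d r k)).
Proof.
move=> hk.
rewrite -(det_col_comb _ (fun l : 'I_k => (fib (d + l + r.+2))%:R)).
rewrite (expand_det_row _ ord0) big_ord_recl big1 ?addr0; last first.
  move=> l _; rewrite !mxE liftK !mxE /= /bump /= add1n fib_run_first.
  by rewrite subrr mul0r.
rewrite !mxE unlift_none /cofactor /= addn0 expr0 mul1r; congr (_ * _).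
pose a (i : 'I_k) : rat := (-1) ^+ d * ((-1) ^+ i * (fib i.+1)%:R).
pose b (j : 'I_k) : rat := (-1) ^+ j * (fib r.+1)%:R.
transitivity (\det (\matrix_(i, j) (a i * b j * fib_run_mx d r k i j))).
  congr (\det _); apply/matrixP => i j.
  rewrite !mxE liftK !mxE /= /bump /= !add1n fib_run_reduce //.
  by have := ltn_ord i; lia.
rewrite det_row_col_scale /a /b !big_split /= !prodr_const card_ord.
(* The signs [(-1)^i] of the rows cancel the signs [(-1)^j] of the columns. *)
have hs : \prod_(i < k) (-1) ^+ i * \prod_(i < k) (-1) ^+ i = 1 :> rat.
  by rewrite -big_split big1 //= => i _; rewrite -expr2 sqrr_sign.
rewrite -exprM -/(fibonorial k).
transitivity ((-1) ^+ (d * k) * fibonorial k * (fib r.+1)%:R ^+ k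
  * \det (fib_run_mx d r k)
  * (\prod_(i < k) (-1) ^+ i * \prod_(i < k) (-1) ^+ i)); first by ring.
by rewrite hs mulr1.
Qed.

Lemma fibo_hoggattSS d n k :
  fibo_hoggatt d n.+1 k.+1
  = fibonomial (n + d) d / fibonomial (k + d) d * fibo_hoggatt d n k.
Proof.
rewrite /fibo_hoggatt big_ord_recl /= !subn0 !addSn !subn1 /=.
by congr (_ * _); apply: eq_bigr => j _; rewrite /bump /= add1n !subSS !subn1.
Qed.

Lemma fibo_hoggatt_det_run d r k : (k <= r.+1)%N ->
  fibo_hoggatt d r.+1 k * fibonorial r ^+ k
  = (-1) ^+ (d * 'C(k, 2)) * \det (fib_run_mx d r k).
Proof.
elim: k r => [|k IH] r hk.
  by rewrite /fibo_hoggatt big_ord0 det_mx00 bin0n muln0 !expr0.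
case: r hk => [|r] hk.
  (* For [r = 0] the bound forces [k = 0], leaving a [1 x 1] determinant whose entry is an empty
     product. *)
  case: k {IH} hk => // _.
  rewrite fibo_hoggattSS /fibo_hoggatt big_ord0 add0n det_mx11 mxE.
  rewrite /fib_run /fibonorial !big_ord0 muln0 expr1n expr0 !mulr1 divff //.
  rewrite -[X in fibonomial X _]add0n fibonomial_sym add0n /fibonorial big_ord0.
  by rewrite mul1r divff ?oner_eq0 //; exact: fibonorial_neq0.
have {}IH := IH r hk; have := @det_fib_run_mxS d r k hk.
(* Pascal's rule [C(k+1, 2) = C(k, 2) + k] yields a sign [(-1)^(d k)], which cancels the one from
   [det_fib_run_mxS]. *)
rewrite fibo_hoggattSS !fibonomial_sym binS bin1 mulnDr exprD.
have -> : fib_run d r.+1 0 0 = \prod_(t < r.+1) (fib (d + t).+1)%:R.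
  by apply: eq_bigr => t _; congr ((fib _)%:R); lia.
have pD m : \prod_(t < m) (fib (d + t).+1)%:R = fibonorial (d + m) / fibonorial d.
  by rewrite fibonorialD mulrAC divff ?mul1r ?fibonorial_neq0.
rewrite !pD ![(_ + d)%N]addnC.
set D := \det _; set D' := \det _; set H := fibo_hoggatt _ _ _ in IH *.
have hk0 := fibonorial_neq0 k; have hd0 := fibonorial_neq0 d.
have hr0 := fibonorial_neq0 r; have hkd := fibonorial_neq0 (d + k).
have hf := fibr_neq0 r.
move=> hD1.
have {hD1}-> : D = fibonorial (d + r.+1) / fibonorial (d + k) * ((-1) ^+ (d * k)
    * fibonorial k * (fib r.+1)%:R ^+ k * D').
  apply: (mulIf (x := fibonorial (d + k) / fibonorial d)).
    by rewrite mulf_neq0 ?invr_neq0.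
  by rewrite hD1; field; rewrite hkd hd0.
transitivity (fibonorial (d + r.+1) / fibonorial (d + k) * fibonorial k
  * (fib r.+1)%:R ^+ k * ((-1) ^+ (d * k) * (-1) ^+ (d * k))
  * ((-1) ^+ (d * 'C(k, 2)) * D')); last by ring.
rewrite -IH -expr2 sqrr_sign fibonorialS exprS exprMn.
by field; rewrite ?hkd ?hd0 ?hr0 ?hf ?hk0.
Qed.

Theorem theorem13 (d n k : nat) (hd : (0 < d)%N) (hn : (0 < n)%N)
    (hk : (k <= n)%N) :
  fibo_hoggatt d n k =
  (-1) ^+ (d * 'C(k, 2)) *
  \det (\matrix_(i < k, j < k) fibonomial (n + d + j - i - 1) (n - 1)).
Proof.
case: n hn hk => // r _ hk.
have -> : \matrix_(i < k, j < k) fibonomial (r.+1 + d + j - i - 1) (r.+1 - 1)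
    = (fibonorial r)^-1 *: fib_run_mx d r k.
  apply/matrixP => i j; rewrite !mxE (subn1 r.+1) fibonomial_run 1?mulrC //.
  by have := ltn_ord i; lia.
(* The scalar leaves the determinant as a [k]-th power and cancels [fibonorial r ^+ k]. *)
rewrite detZ mulrCA -fibo_hoggatt_det_run // mulrCA -exprMn.
by rewrite mulVf ?fibonorial_neq0 // expr1n mulr1.
Qed.
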